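(* For every positive integer $N$, $$\sum_{\lambda\in\mathcal{OP}_N} t^{\ell(\lambda)}q^{|\lambda|}=\sum_{\mu\in\mathcal{L}_N} t^{|\mu|_a}q^{|\mu|}=\prod_{k=1}^{N}\frac{1}{1-tq^{2k-1}}$$ as formal power series in $t,q$.
   Context: A partition is a finite weakly decreasing sequence $\lambda=(\lambda_1\ge\lambda_2\ge\dots\ge\lambda_\ell>0)$ of positive integers (the empty partition $\emptyset$ is allowed); $\ell(\lambda)=\ell$ is its length and $|\lambda|=\sum_i\lambda_i$ its size. The alternating size is $|\lambda|_a=\sum_{k=1}^{\ell(\lambda)}(-1)^{k+1}\lambda_k$. For a positive integer $N$, $\mathcal{L}_N$ is the set of partitions $\mu$ with $\ell(\mu)\le N$ and $$\frac{\mu_1}{N}\ge\frac{\mu_2}{N-1}\ge\dots\ge\frac{\mu_{\ell(\mu)}}{N-\ell(\mu)+1}$$ (lecture hall partitions of width $N$; $\emptyset\in\mathcal{L}_N$). $\mathcal{OP}_N$ is the set of partitions all of whose parts are odd and at most $2N$ (so parts lie in $\{1,3,\dots,2N-1\}$). *)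

(* Defs.v *)
From HB Require Import structures.
From mathcomp Require Import all_boot all_order all_algebra.
From mathcomp Require Import boolp classical_sets functions cardinality fsbigop.
Set Implicit Arguments.
Unset Strict Implicit.
Unset Printing Implicit Defensive.
Import Order.TTheory GRing.Theory Num.Theory.
Local Open Scope classical_set_scope.
Local Open Scope ring_scope.

(** * Formal power series in one variable over a commutative ring *)

Record fps (R : Type) := Fps { fps_coef :> nat -> R }.

HB.instance Definition _ (R : Type) := gen_eqMixin (fps R).
HB.instance Definition _ (R : Type) := gen_choiceMixin (fps R).

Lemma fpsP (R : Type) (f g : fps R) : f =1 g -> f = g.
Proof. by case: f g => [f] [g] /funext /= ->. Qed.

Section FpsRing.
Variable R : comNzRingType.
Implicit Types f g h : fps R.

Definition fps_zero : fps R := Fps (fun=> 0).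
Definition fps_opp f : fps R := Fps (fun n => - f n).
Definition fps_add f g : fps R := Fps (fun n => f n + g n).
Definition fps_one : fps R := Fps (fun n => (n == 0%N)%:R).
Definition fps_mul f g : fps R :=
  Fps (fun n => \sum_(i < n.+1) f i * g (n - i)%N).

Fact fps_addA : associative fps_add.
Proof. by move=> f g h; apply: fpsP => n /=; rewrite addrA. Qed.
Fact fps_addC : commutative fps_add.
Proof. by move=> f g; apply: fpsP => n /=; rewrite addrC. Qed.
Fact fps_add0 : left_id fps_zero fps_add.
Proof. by move=> f; apply: fpsP => n /=; rewrite add0r. Qed.
Fact fps_addN : left_inverse fps_zero fps_opp fps_add.
Proof. by move=> f; apply: fpsP => n /=; rewrite addNr. Qed.

HB.instance Definition _ :=
  GRing.isZmodule.Build (fps R) fps_addA fps_addC fps_add0 fps_addN.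

Let trunc n f : {poly R} := \poly_(i < n.+1) f i.

Let fps_mul_trunc m n f g : (n <= m)%N ->
  fps_mul f g n = (trunc m f * trunc m g)`_n.
Proof.
move=> lenm; rewrite coefM /=; apply: eq_bigr => i _; rewrite !coef_poly !ltnS.
by rewrite (leq_trans (leq_ord i) lenm) (leq_trans (leq_subr i n) lenm).
Qed.

Fact fps_mulC : commutative fps_mul.
Proof.
by move=> f g; apply: fpsP => n; rewrite !(@fps_mul_trunc n n)// mulrC.
Qed.

Fact fps_mulA : associative fps_mul.
Proof.
move=> f g h; apply: fpsP => n.
transitivity ((trunc n f * (trunc n g * trunc n h))`_n).
  rewrite coefM; apply: eq_bigr => i _.
  by rewrite (@fps_mul_trunc n) ?leq_subr// coef_poly ltn_ord.
rewrite mulrA coefM; apply: eq_bigr => i _.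
by rewrite -(@fps_mul_trunc n) ?leq_ord// coef_poly ltnS leq_subr.
Qed.

Fact fps_mul1 : left_id fps_one fps_mul.
Proof.
move=> f; apply: fpsP => n /=; rewrite big_ord_recl /= mul1r subn0.
by rewrite big1 ?addr0// => i _; rewrite mul0r.
Qed.

Fact fps_mulDl : left_distributive fps_mul fps_add.
Proof.
move=> f g h; apply: fpsP => n /=; rewrite -big_split /=.
by apply: eq_bigr => i _; rewrite mulrDl.
Qed.

Fact fps_one_neq0 : fps_one != fps_zero.
Proof.
by apply/eqP => /(congr1 (fun f : fps R => f 0%N))/eqP; rewrite oner_eq0.
Qed.

HB.instance Definition _ := GRing.Zmodule_isComNzRing.Build (fps R)
  fps_mulA fps_mulC fps_mul1 fps_mulDl fps_one_neq0.

Definition fps_unit : {pred fps R} := [pred f | `[< exists g, g * f = 1 >]].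

(* As everywhere in the library, the inverse of a non-unit is itself. *)
Definition fps_inv f : fps R := xget f [set g | g * f = 1].

Fact fps_mulV : {in fps_unit, left_inverse 1 fps_inv *%R}.
Proof.
by move=> f /asboolP[g gf1]; rewrite /fps_inv; case: xgetP => // /(_ g).
Qed.

Fact fps_unitPl f g : g * f = 1 -> fps_unit f.
Proof. by move=> gf1; apply/asboolP; exists g. Qed.

Fact fps_inv_out : {in [predC fps_unit], fps_inv =1 id}.
Proof.
move=> f /asboolP nf; rewrite /fps_inv; case: xgetP => // g _ gf1.
by case: nf; exists g.
Qed.

HB.instance Definition _ := GRing.ComNzRing_hasMulInverse.Build (fps R)
  fps_mulV fps_unitPl fps_inv_out.

Definition fpsX : fps R := Fps (fun n => (n == 1%N)%:R).
Definition fpsC (c : R) : fps R := Fps (fun n => if n == 0%N then c else 0).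

Lemma coef_fpsM f g n : (f * g) n = \sum_(i < n.+1) f i * g (n - i)%N.
Proof. by []. Qed.

Lemma coef_fpsXM f n : (fpsX * f) n = if n is m.+1 then f m else 0.
Proof.
rewrite coef_fpsM; case: n => [|n]; first by rewrite big_ord1 mul0r.
rewrite 2!big_ord_recl /= mul0r add0r mul1r subn1 /=.
by rewrite big1 ?addr0// => i _; rewrite mul0r.
Qed.

Lemma coef_fpsMC f c n : (f * fpsC c) n = f n * c.
Proof.
rewrite coef_fpsM big_ord_recr /= subnn /= big1 ?add0r// => i _.
by rewrite subn_eq0 leqNgt ltn_ord /= mulr0.
Qed.

Lemma coef_fpsXn m n : (fpsX ^+ m) n = (n == m)%:R.
Proof.
elim: m n => [|m IHm] n; first by rewrite expr0.
by rewrite exprS coef_fpsXM; case: n => // n; rewrite IHm eqSS.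
Qed.

Lemma fpsCX c n : fpsC c ^+ n = fpsC (c ^+ n).
Proof.
elim: n => [|n IHn]; first by apply: fpsP => -[].
apply: fpsP => m; rewrite exprSr IHn coef_fpsMC exprSr /=.
by case: eqP; rewrite ?mul0r.
Qed.

Lemma fps_unit_1subX c : 1 - fpsX * fpsC c \is a GRing.unit.
Proof.
apply: (@fps_unitPl _ (Fps (fun n => c ^+ n))).
rewrite mulrC mulrBl mul1r -mulrA [fpsC c * _]mulrC; apply: fpsP => n.
rewrite -[LHS]/(c ^+ n - (fpsX * _) n) coef_fpsXM.
case: n => [|n]; first by rewrite subr0.
by rewrite coef_fpsMC exprSr subrr.
Qed.

End FpsRing.

(** * Formal power series in [t] and [q]: Z[[t,q]] is taken to be Z[[q]][[t]],
    so that [f a b] is the coefficient of t^a q^b in [f]. *)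

Notation fps2 := (fps (fps int)).

Definition t : fps2 := fpsX (fps int).
Definition q : fps2 := fpsC (fpsX int).

Lemma coef_monomial (m n a b : nat) :
  (t ^+ m * q ^+ n) a b = ((a == m) && (b == n))%:R.
Proof.
rewrite /q fpsCX coef_fpsMC coef_fpsXn.
by case: (a == m); rewrite ?mul0r// mul1r coef_fpsXn.
Qed.

Lemma unit_1sub_tqn (n : nat) : (1 - t * q ^+ n) \is a GRing.unit.
Proof. by rewrite /q fpsCX fps_unit_1subX. Qed.

(* A family is summable when each coefficient receives finitely many nonzero
   contributions; [\sum_(i \in A) _] is the sum over the finite support. *)
Definition fps2_summable (I : choiceType) (A : set I) (F : I -> fps2) : Prop :=
  forall a b : nat, finite_set (A `&` [set i | F i a b != 0]).

Definition fps2_sum (I : choiceType) (A : set I) (F : I -> fps2) : fps2 :=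
  Fps (fun a => Fps (fun b => \sum_(i \in A) F i a b)).

(** * Partitions, as weakly decreasing sequences of positive integers.
    The part lambda_(k+1) is [nth 0 la k], the length is [size la], and the
    size |lambda| is [sumn la]. *)

Definition is_partition (la : seq nat) : bool :=
  sorted geq la && all (leq 1) la.

Definition alt_size (la : seq nat) : int :=
  \sum_(1 <= k < (size la).+1) (-1) ^+ k.+1 * (nth 0%N la k.-1)%:Z.

(* With 0-based indices mu_(i+1) = nth 0 mu i. *)
Definition lecture_hall (N : nat) : set (seq nat) :=
  [set mu | [/\ is_partition mu, (size mu <= N)%N &
    forall i : nat, (i.+1 < size mu)%N ->
      (nth 0%N mu i.+1)%:R / (N - i.+1)%:R
        <= (nth 0%N mu i)%:R / (N - i)%:R :> rat]].

Definition odd_partitions (N : nat) : set (seq nat) :=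
  [set la | is_partition la /\ all (fun x => odd x && (x <= 2 * N)%N) la].

Lemma alt_size_cons (x : nat) (la : seq nat) :
  alt_size (x :: la) = x%:Z - alt_size la.
Proof.
rewrite /alt_size /= big_nat_recl//= expr2 mulrNN !mul1r; congr (_ + _).
rewrite -sumrN big_add1 [RHS]big_add1 /=; apply: eq_bigr => k _.
by rewrite [in LHS]exprS mulN1r mulNr.
Qed.

(* Hence the exponent of [t] in [t ^ alt_size mu] is never negative. *)
Lemma alt_size_ge0 (la : seq nat) : is_partition la -> 0 <= alt_size la.
Proof.
case/andP => + _.
suff : sorted geq la -> 0 <= alt_size la <= (head 0 la)%:Z.
  by move=> H /H /andP[].
elim: la => [_|x la IHla] /=; first by rewrite /alt_size big_geq.
move=> xla; have /andP[h0 h1] := IHla (path_sorted xla).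
rewrite alt_size_cons subr_ge0 gerBl h0 andbT (le_trans h1)//.
by case: la xla {IHla h0 h1} => //= y la /andP[].
Qed.

Lemma finite_partitions (n : nat) :
  finite_set [set la | is_partition la /\ sumn la = n].
Proof.
pose l := flatten [seq [seq map val (tval u) | u <- enum {: k.-tuple 'I_n.+1}]
                  | k <- iota 0 n.+1].
apply: (sub_finite_set _ (finite_seq l)) => la /= [/andP[_ la1] lan].
have sz : (size la <= n)%N.
  rewrite -lan; elim: la la1 {lan} => //= x la IH /andP[x0 /IH].
  by move=> h; rewrite -add1n leq_add.
have bd : all (fun x => x <= n)%N la.
  apply/allP => x xla; rewrite -lan; elim: la xla {la1 lan sz} => //= y la IH.
  rewrite inE => /orP[/eqP->|/IH h]; first exact: leq_addr.
  exact: leq_trans h (leq_addl _ _).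
apply/flatten_mapP; exists (size la); first by rewrite mem_iota.
have hs : size (map (@inord n) la) == size la by rewrite size_map.
apply/mapP; exists (Tuple hs); first by rewrite mem_enum.
rewrite /= -map_comp -[LHS]map_id; apply/eq_in_map => x /(allP bd) xn.
by rewrite /= inordK.
Qed.

Lemma summable_partitions (A : set (seq nat)) (e : seq nat -> nat) :
  A `<=` is_partition -> fps2_summable A (fun la => t ^+ e la * q ^+ sumn la).
Proof.
move=> Ap a b; apply: (sub_finite_set _ (finite_partitions b)) => la /= [Ala].
rewrite coef_monomial; case: (b =P _) => [-> _|]; last by rewrite andbF.
by split=> //; exact: Ap.
Qed.

Lemma summable_odd_partitions (N : nat) :
  fps2_summable (odd_partitions N) (fun la => t ^+ size la * q ^+ sumn la).
Proof. by apply: summable_partitions => la []. Qed.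

Lemma summable_lecture_hall (N : nat) :
  fps2_summable (lecture_hall N) (fun mu => t ^ alt_size mu * q ^+ sumn mu).
Proof.
move=> a b.
have : fps2_summable (lecture_hall N) (fun mu =>
    t ^+ absz (alt_size mu) * q ^+ sumn mu).
  by apply: summable_partitions => mu [].
move=> /(_ a b); apply: sub_finite_set => mu /= [Lmu]; split=> //.
case: Lmu => /alt_size_ge0 ge0 _ _.
by rewrite exprnP (gez0_abs ge0).
Qed.

(* Main.v *)
(* Write [G_N] for the generating function of lecture hall partitions of width
   [N]. Fix the even-indexed entries of a lecture hall sequence
   (mu_1, ..., mu_(N+1)), padded with zeros. Each later odd-indexed entry ranges
   over an interval, which can be reflected, while mu_1 is only bounded below,
   say by m. Since floor((k-1)y/k) + ceil((k+1)y/k) = 2y, reflecting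
   (mu_2, ..., mu_(N+1)) when mu_1 = m gives a lecture hall sequence nu of
   width N with |mu|_a = |nu|_a and |mu| = |nu| + 2|nu|_a. Lowering mu_1 by one
   when mu_1 > m therefore gives (1 - t q) G_(N+1)(t, q) = G_N(t q^2, q), a
   recursion which the product satisfies as well. Partitions into odd parts are
   treated by removing the part 2N - 1. *)
Require Import Defs.
From mathcomp Require Import all_boot all_order all_algebra.
From mathcomp Require Import boolp classical_sets functions cardinality fsbigop.
From mathcomp Require Import zify ring.
Import Order.TTheory GRing.Theory Num.Theory.
Local Open Scope ring_scope.

(** * Coefficient extraction and the substitution in [t] *)

Lemma coef_fpsXnM (R : comNzRingType) (m : nat) (f : fps R) (n : nat) :
  (fpsX R ^+ m * f) n = if (m <= n)%N then f (n - m)%N else 0.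
Proof.
elim: m n => [|m IHm] n; first by rewrite expr0 mul1r subn0.
by rewrite exprS -mulrA coef_fpsXM; case: n => // n; rewrite IHm ltnS subSS.
Qed.

Lemma coef_monomialM (m n : nat) (f : fps2) (a b : nat) :
  (t ^+ m * q ^+ n * f) a b =
    if (m <= a)%N && (n <= b)%N then f (a - m)%N (b - n)%N else 0.
Proof.
rewrite /q fpsCX -mulrA coef_fpsXnM; case: (m <= a)%N; last by [].
by rewrite andTb [fpsC _ * f]mulrC coef_fpsMC mulrC coef_fpsXnM.
Qed.

(* The substitution [t := t * q ^+ 2]. *)
Definition twist (f : fps2) : fps2 := Fps (fun a => fpsX int ^+ (2 * a) * f a).

Lemma twistM (f g : fps2) : twist (f * g) = twist f * twist g.
Proof.
apply: fpsP => a; rewrite -[LHS]/(_ * (f * g) a) !coef_fpsM mulr_sumr.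
apply: eq_bigr => -[i /= ia] _.
have -> : (2 * a = 2 * i + 2 * (a - i))%N by lia.
rewrite exprD; ring.
Qed.

Lemma twist1 : twist 1 = 1.
Proof. by apply: fpsP => -[|a]; rewrite /= ?mulr0// mul1r. Qed.

Lemma twist_monomial (m n : nat) :
  twist (t ^+ m * q ^+ n) = t ^+ m * q ^+ (n + 2 * m).
Proof.
apply: fpsP => a; apply: fpsP => b.
rewrite [LHS]coef_fpsXnM !coef_monomial.
case: ifP => h; [congr (_%:R)|rewrite (_ : _ && _ = false)//]; lia.
Qed.

Lemma twist_1sub (n : nat) : twist (1 - t * q ^+ n) = 1 - t * q ^+ n.+2.
Proof.
have twistB f g : twist (f - g) = twist f - twist g.
  by apply: fpsP => a; rewrite /= mulrBr.
by rewrite twistB twist1 -(expr1 t) twist_monomial addn2.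
Qed.

Lemma twist_inv (f : fps2) : f \is a GRing.unit -> twist f^-1 = (twist f)^-1.
Proof.
move=> uf; have fV : twist f^-1 * twist f = 1.
  by rewrite -twistM mulVr// twist1.
have utf : twist f \is a GRing.unit by apply: fps_unitPl fV.
by apply: (mulIr utf); rewrite fV mulVr.
Qed.

(** * Generating functions of weighted sets *)

Definition gf {I : choiceType} (A : set I) (e w : I -> nat) : fps2 :=
  fps2_sum A (fun i => t ^+ e i * q ^+ w i).

Lemma coef_gf {I : choiceType} (A : set I) (e w : I -> nat) (a b : nat) :
  gf A e w a b = \sum_(i \in A) (((a == e i) && (b == w i))%:R : int).
Proof. by apply: eq_fsbigr => i _; rewrite coef_monomial. Qed.

Lemma gf_image {I J : choiceType} (h : I -> J) (A : set I) (e w : J -> nat) :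
  {in A &, injective h} -> gf (h @` A) e w = gf A (e \o h) (w \o h).
Proof.
move=> hinj; apply: fpsP => a; apply: fpsP => b; rewrite !coef_gf.
exact: (reindex_fsbig (inj_bij hinj)).
Qed.

Lemma eq_gf {I : choiceType} (A : set I) (e e' w w' : I -> nat) :
  (forall i, A i -> e i = e' i) -> (forall i, A i -> w i = w' i) ->
  gf A e w = gf A e' w'.
Proof.
move=> ee ww; apply: fpsP => a; apply: fpsP => b; rewrite !coef_gf.
by apply: eq_fsbigr => i; rewrite inE => Ai; rewrite ee ?ww.
Qed.

(** Summability matters here: a sum over an infinite support is 0 by convention, which would break
    additivity. *)
Lemma gfU {I : choiceType} (A B : set I) (e w : I -> nat) :
  fps2_summable (A `|` B)%classic (fun i => t ^+ e i * q ^+ w i) ->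
  (forall i, A i -> ~ B i) ->
  gf (A `|` B)%classic e w = gf A e w + gf B e w.
Proof.
move=> sAB dAB; apply: fpsP => a; apply: fpsP => b.
rewrite -[RHS]/(gf A e w a b + gf B e w a b).
rewrite /gf /fps2_sum /= fsbig_supp setIUl fsbigU0.
- by rewrite -!fsbig_supp.
- apply: sub_finite_set (sAB a b) => i /= [Ai /eqP fi]; split=> //; by left.
- apply: sub_finite_set (sAB a b) => i /= [Ai /eqP fi]; split=> //; by right.
- by move=> i [[Ai _] [Bi _]]; case: (dAB i).
Qed.

Lemma gf_shift {I : choiceType} (A : set I) (e w : I -> nat) (m n : nat) :
  gf A (fun i => (m + e i)%N) (fun i => (n + w i)%N) =
    t ^+ m * q ^+ n * gf A e w.
Proof.
apply: fpsP => a; apply: fpsP => b; rewrite coef_monomialM !coef_gf.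
case: ifP => h; first by apply: eq_fsbigr => i _; congr (_%:R); lia.
by apply: fsbig1 => i _; rewrite (_ : _ && _ = false)//; lia.
Qed.

Lemma twist_gf {I : choiceType} (A : set I) (e w : I -> nat) :
  twist (gf A e w) = gf A e (fun i => (w i + 2 * e i)%N).
Proof.
apply: fpsP => a; apply: fpsP => b; rewrite [LHS]coef_fpsXnM !coef_gf.
case: ifP => h; first by apply: eq_fsbigr => i _; congr (_%:R); lia.
by apply/esym/fsbig1 => i _; rewrite (_ : _ && _ = false)//; lia.
Qed.

Lemma gf_nil (e w : seq nat -> nat) : e [::] = 0%N -> w [::] = 0%N ->
  gf [set [::]]%classic e w = 1.
Proof.
move=> e0 w0; apply: fpsP => a; apply: fpsP => b.
by rewrite coef_gf fsbig_set1 e0 w0 -coef_monomial !expr0 mulr1.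
Qed.

(** * The product and its two recursions *)

Definition odd_product (N : nat) : fps2 :=
  \prod_(1 <= k < N.+1) (1 - t * q ^+ (2 * k - 1))^-1.

Lemma product_recr (N : nat) :
  odd_product N.+1 = (1 - t * q ^+ (2 * N).+1)^-1 * odd_product N.
Proof.
rewrite /odd_product big_nat_recr//= mulrC.
congr ((1 - t * q ^+ _)^-1 * _); lia.
Qed.

(** [twist] raises each exponent [2 * k - 1] to the next odd number, so only the factor with [t * q]
    is missing. *)
Lemma product_recl (N : nat) :
  odd_product N.+1 = (1 - t * q)^-1 * twist (odd_product N).
Proof.
have := product_recr; have : odd_product 0 = 1 by rewrite /odd_product big_geq.
move: odd_product => P P0 PS.
elim: N => [|N IHN]; first by rewrite PS P0 twist1 expr1.
rewrite (PS N.+1) {1}IHN (PS N) twistM twist_inv; last exact: unit_1sub_tqn.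
rewrite twist_1sub mulrCA; have -> : (2 * N.+1).+1 = (2 * N).+3 by lia.
reflexivity.
Qed.

(** Solves the recursions that arise when a set is the disjoint union of a simpler set and a shifted
    copy of itself. *)
Lemma geometric (c x y : fps2) : 1 - c \is a GRing.unit ->
  x = y + c * x -> x = (1 - c)^-1 * y.
Proof.
move=> uc xy; apply: (mulrI uc); rewrite mulVKr//.
by rewrite mulrBl mul1r {1}xy addrK.
Qed.

(** * Partitions into odd parts *)

Lemma odd_partitions0 : odd_partitions 0 = [set [::]]%classic.
Proof.
apply/seteqP; split=> [[|x la]|la ->]//= [_ /andP[/andP[ox]]].
by rewrite leqn0 => /eqP x0; rewrite x0 in ox.
Qed.

Lemma odd_partitionsS (N : nat) :
  odd_partitions N.+1 =
    (odd_partitions N `|` cons (2 * N).+1 @` odd_partitions N.+1)%classic.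
Proof.
apply/seteqP; split.
  case=> [|x la]; first by left.
  move=> [/andP[/= srt /andP[x0 pos]] /= /andP[/andP[ox xN] odd]].
  case: (x =P (2 * N).+1) => [xE|xN'].
    right; exists la; last by rewrite xE.
    by split=> //; apply/andP; split=> //; apply: path_sorted srt.
  left; split; first by rewrite /is_partition /= srt x0 pos.
  (* The given bound is 2N + 2, which the odd [x] cannot attain, and 2N + 1 is excluded in this
     case. *)
  have xle : (x <= 2 * N)%N.
    have xNE : x <> (2 * N.+1)%N.
      by move=> xE; move: ox; rewrite xE mul2n odd_double.
    lia.
  rewrite /= ox xle /=; apply/allP => y yla.
  move/allP: odd => /(_ _ yla) /andP[-> _] /=.
  have /allP /(_ _ yla) := order_path_min (rev_trans leq_trans) srt.
  by move=> yx; apply: leq_trans yx xle.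
move=> la [[pla odd]|[mu [/andP[srt pos] odd] <-]].
  split=> //; apply: sub_all odd => x /andP[-> xN] /=; lia.
split; last first.
  by rewrite /= odd andbT mul2n /= odd_double /=; lia.
rewrite /is_partition /= pos andbT path_min_sorted//.
apply/allP => y /(allP odd) /andP[oy yN].
have : y <> (2 * N.+1)%N by move=> xE; move: oy; rewrite xE mul2n odd_double.
rewrite /=; lia.
Qed.

Lemma gf_odd_partitions (N : nat) :
  gf (odd_partitions N) size sumn = odd_product N.
Proof.
elim: N => [|N IHN].
  by rewrite odd_partitions0 gf_nil// /odd_product big_geq.
rewrite product_recr -IHN; apply: geometric; first exact: unit_1sub_tqn.
rewrite [in LHS]odd_partitionsS gfU; first last.
- move=> la [_ odd] [mu _ laE]; move: odd; rewrite -laE /=; lia.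
- by rewrite -odd_partitionsS; apply: summable_odd_partitions.
congr (_ + _); rewrite gf_image; last by move=> x y _ _ [].
by rewrite -(expr1 t) -gf_shift.
Qed.

(** * Lecture hall sequences and the reflection *)

Definition divup (k y : nat) : nat := ((y + k.-1) %/ k)%N.

Lemma divup_leq (k y z : nat) : (0 < k)%N ->
  (divup k y <= z)%N = (y <= z * k)%N.
Proof. by move=> k0; rewrite -ltnS ltn_divLR// mulSn; lia. Qed.

Lemma divup_leq_id (k y : nat) : (0 < k)%N -> (divup k y <= y)%N.
Proof. by move=> k0; rewrite divup_leq//; nia. Qed.

Lemma addn_divup_leq (k x y : nat) : (0 < k)%N ->
  (y + divup k y <= x)%N = (k.+1 * y <= k * x)%N.
Proof.
move=> k0; case: (leqP y x) => yx; last by nia.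
have -> : (y + divup k y <= x)%N = (divup k y <= x - y)%N by lia.
by rewrite divup_leq// mulnBl; nia.
Qed.

(** [x - divup k.+1 x] is floor(k x / (k + 1)), the largest entry that may follow [x] when [k]
    entries remain. *)
Lemma leq_sub_divup (k x y : nat) :
  (y <= x - divup k.+1 x)%N = (k.+1 * y <= k * x)%N.
Proof.
have cx := divup_leq_id k.+1 x isT.
case: (leqP y x) => yx; last by nia.
have -> : (y <= x - divup k.+1 x)%N = (divup k.+1 x <= x - y)%N by lia.
by rewrite divup_leq// mulnBl; nia.
Qed.

(* [ceil ((n + 1) * y / n)] for [n = size s] and [y = head 0 s]: the least entry
   that may precede [s]. *)
Definition min_head (s : seq nat) : nat :=
  (head 0 s + divup (size s) (head 0 s))%N.

(* Lecture hall sequences of width exactly [size s], zero entries allowed. *)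
Fixpoint lh_seq (s : seq nat) : bool :=
  if s is x :: s' then (min_head s' <= x)%N && lh_seq s' else true.

(* The sequence begins with a second entry mu_2, so the reflected entries
   mu_3, mu_5, ... are those in even position here. *)
Fixpoint flip (s : seq nat) : seq nat :=
  if s is y :: z :: s' then
    y :: (y - divup (size s) y + min_head s' - z)%N :: flip s'
  else s.

(** Follows the recursion of [flip], which consumes two entries at a time. *)
Lemma seq_pair_ind (P : seq nat -> Prop) :
  P [::] -> (forall x, P [:: x]) -> (forall x y s, P s -> P (x :: y :: s)) ->
  forall s, P s.
Proof.
move=> P0 P1 P2 s; suff : P s /\ forall x, P (x :: s) by case.
by elim: s => [|x s [Ps Pxs]]; split=> // y; apply: P2.
Qed.

Lemma size_flip (s : seq nat) : size (flip s) = size s.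
Proof. by elim/seq_pair_ind: s => //= x y s ->. Qed.

Lemma head_flip (s : seq nat) : head 0%N (flip s) = head 0%N s.
Proof. by case: s => [|x []]. Qed.

Lemma min_head_flip (s : seq nat) : min_head (flip s) = min_head s.
Proof. by rewrite /min_head size_flip head_flip. Qed.

(** Once its neighbours are fixed, [z] ranges from [min_head s] to this upper end; [flip] replaces
    it by the sum of the two ends minus [z]. *)
Lemma min_head_leq (y z : nat) (s : seq nat) :
  (min_head (z :: s) <= y)%N = (z <= y - divup (size s).+2 y)%N.
Proof. by rewrite leq_sub_divup addn_divup_leq. Qed.

(** The interval of a reflected entry depends only on its neighbours, which [flip] keeps, so the
    reflections do not interfere. *)
Lemma lh_flip (s : seq nat) : lh_seq s -> lh_seq (flip s).
Proof.
elim/seq_pair_ind: s => //= y z s IH /and3P[zy sz /IH ->].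
move: zy; rewrite !min_head_leq size_flip min_head_flip; lia.
Qed.

Lemma flipK (s : seq nat) : lh_seq s -> flip (flip s) = s.
Proof.
elim/seq_pair_ind: s => //= y z s IH /and3P[zy sz /IH ->].
move: zy; rewrite min_head_leq size_flip min_head_flip => zy.
congr [:: _, _ & _]; rewrite subKn//.
exact: leq_trans zy (leq_addr _ _).
Qed.

(** For [y :: z :: s] the new head is [y + c] and the reflected entry is [y - c + min_head s - z],
    with the same rounded quotient [c]. Their signs agree, so [c] cancels, and [min_head s] serves
    as the head in the induction hypothesis. *)
Lemma alt_flip (s : seq nat) : lh_seq s ->
  alt_size (min_head s :: flip s) = alt_size s.
Proof.
rewrite alt_size_cons; elim/seq_pair_ind: s => [_|x _|y z s IH]/=.
- by rewrite /alt_size big_geq.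
- rewrite /min_head /= /divup addn0 divn1 !alt_size_cons /alt_size big_geq//.
  lia.
case/and3P => zy sz /IH; rewrite !alt_size_cons.
move: zy; rewrite min_head_leq [min_head (_ :: _)]/min_head /=.
have := divup_leq_id (size s).+2 y isT; lia.
Qed.

(** With the same cancellation, the pair [y], [z] contributes 3y - z = (y + z) + 2(y - z). *)
Lemma sumn_flip (s : seq nat) : lh_seq s ->
  (sumn (min_head s :: flip s))%:Z = (sumn s)%:Z + 2 * alt_size s.
Proof.
elim/seq_pair_ind: s => [_|x _|y z s IH]/=.
- by rewrite /alt_size big_geq.
- rewrite /min_head /= /divup addn0 divn1 !alt_size_cons /alt_size big_geq//.
  lia.
case/and3P => zy sz /IH; rewrite !alt_size_cons.
move: zy; rewrite min_head_leq [min_head (_ :: _)]/min_head /=.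
have := divup_leq_id (size s).+2 y isT; lia.
Qed.

(** * Recursion on the width, with zeros kept so that width is length *)

Definition padded_lecture_hall (N : nat) : set (seq nat) :=
  [set s | size s = N /\ lh_seq s]%classic.

Definition bump (s : seq nat) : seq nat := (head 0 s).+1 :: behead s.

Lemma padded_lecture_hallS (N : nat) :
  padded_lecture_hall N.+1 =
    ((fun s => min_head s :: flip s) @` padded_lecture_hall N `|`
     bump @` padded_lecture_hall N.+1)%classic.
Proof.
apply/seteqP; split.
  case=> [|x s] [//] [sN] /= /andP[xs lhs].
  case: (ltngtP (min_head s) x) xs => // xs _.
    right; case: x xs => // x xs; exists (x :: s) => //.
    by split; rewrite /= ?sN// lhs andbT.
  (* Since [flip] is an involution, [flip s] is the preimage. *)
  left; exists (flip s); first by split; rewrite ?size_flip ?lh_flip.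
  by rewrite min_head_flip flipK// xs.
move=> _ [[s [sN lhs] <-]|[[|x s] [//= sN /andP[xs lhs]] <-]].
  by split; rewrite /= ?size_flip ?sN// min_head_flip leqnn lh_flip.
by split; rewrite //= lhs andbT ltnW.
Qed.

(** * Comparison with lecture hall partitions *)

Lemma lh_seqP (s : seq nat) :
  reflect (forall i : nat, (i.+1 < size s)%N ->
             ((size s - i) * nth 0 s i.+1 <= (size s - i.+1) * nth 0 s i)%N)
          (lh_seq s).
Proof.
elim: s => [|x s IH]; first by apply: ReflectT.
have hd : (0 < size s)%N -> (min_head s <= x)%N =
    ((size s).+1 * nth 0 s 0 <= size s * x)%N.
  by move=> s0; rewrite nth0 addn_divup_leq.
rewrite /=; apply: (iffP andP) => [[xs /IH lhs] [|i]|lhs].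
- by rewrite ltnS subn0 subn1 /= => s0; rewrite -hd.
- by rewrite ltnS subSS => /lhs; rewrite subSS.
split.
  (* For empty [s], [divup 0 0] is 0 by the convention for division by zero, so a last entry is
     unrestricted. *)
  case: s hd lhs {IH} => // y s /(_ isT) -> lhs.
  by have := lhs 0%N isT; rewrite subn0 subn1.
by apply/IH => i si; have := lhs i.+1 si; rewrite !subSS.
Qed.

Lemma lh_sorted (s : seq nat) : lh_seq s -> sorted geq s.
Proof.
elim: s => // x [|y s] IH //= /andP[yx /IH] /= -> ; rewrite andbT.
exact: leq_trans (leq_addr _ _) yx.
Qed.

Definition pad (N : nat) (s : seq nat) : seq nat := s ++ nseq (N - size s) 0%N.

Lemma padK (N : nat) (s : seq nat) :
  all (leq 1) s -> filter (leq 1) (pad N s) = s.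
Proof.
move=> s0; rewrite /pad filter_cat (all_filterP s0).
by rewrite (_ : [seq _ <- nseq _ _ | _] = [::]) ?cats0//; elim: (N - _)%N.
Qed.

(** In a weakly decreasing sequence all zeros come last. *)
Lemma sorted_pad (s : seq nat) :
  sorted geq s -> pad (size s) (filter (leq 1) s) = s.
Proof.
elim: s => // -[|x] s IH /= srt; last first.
  by rewrite /pad /= subSS -[in RHS](IH (path_sorted srt)).
have s0 : s = nseq (size s) 0%N.
  have srt0 := order_path_min (rev_trans leq_trans) srt.
  apply/all_pred1P; apply: sub_all srt0 => y /=.
  by rewrite leqn0.
rewrite /pad s0 size_nseq (_ : [seq _ <- nseq _ _ | _] = [::])//.
by elim: (size s).
Qed.

Lemma nth_pad (N : nat) (s : seq nat) (i : nat) :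
  nth 0%N (pad N s) i = nth 0%N s i.
Proof.
rewrite nth_cat; case: ltnP => // si.
by rewrite nth_nseq if_same nth_default.
Qed.

Lemma sumn_pad (N : nat) (s : seq nat) : sumn (pad N s) = sumn s.
Proof. by rewrite sumn_cat sumn_nseq mul0n addn0. Qed.

Lemma alt_size_pad (N : nat) (s : seq nat) : alt_size (pad N s) = alt_size s.
Proof.
rewrite /pad; elim: s (N - _)%N => [|x s IH] k /=.
  by elim: k => //= k IH; rewrite alt_size_cons IH /alt_size big_geq.
by rewrite !alt_size_cons IH.
Qed.

Lemma lecture_hall_ratio (N i x y : nat) : (i.+1 < N)%N ->
  (y%:R / (N - i.+1)%:R <= x%:R / (N - i)%:R :> rat) =
  ((N - i) * y <= (N - i.+1) * x)%N.
Proof.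
move=> iN; have [p1 p2] : (0 < N - i.+1)%N /\ (0 < N - i)%N by lia.
rewrite ler_pdivrMr ?ltr0n// mulrAC ler_pdivlMr ?ltr0n//.
by rewrite -!natrM ler_nat mulnC [(x * _)%N]mulnC.
Qed.

Lemma padded_lecture_hallE (N : nat) :
  padded_lecture_hall N = (pad N @` lecture_hall N)%classic.
Proof.
apply/seteqP; split=> [s [sN lhs]|_ [mu [/andP[srt pos] muN rat] <-]].
  have srt := lh_sorted _ lhs; have padE := sorted_pad _ srt.
  exists (filter (leq 1) s); last by rewrite -sN.
  have fN : (size (filter (leq 1) s) <= N)%N.
    by rewrite -sN size_filter count_size.
  split=> // [|i si].
    rewrite /is_partition filter_all andbT.
    by rewrite (sorted_filter (rev_trans leq_trans)).
  rewrite lecture_hall_ratio; last exact: leq_trans si fN.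
  rewrite -(nth_pad (size s) _ i.+1) -(nth_pad (size s) _ i) padE -sN.
  apply/lh_seqP => //.
  by rewrite sN; apply: leq_trans si fN.
have szN : size (pad N mu) = N by rewrite size_cat size_nseq subnKC.
split=> //; apply/lh_seqP => i; rewrite szN !nth_pad => iN.
(* Past the last part of [mu] the next entry is a padding zero and the inequality is trivial. *)
case: (ltnP i.+1 (size mu)) => si; last by rewrite (nth_default _ si) muln0.
by rewrite -lecture_hall_ratio ?rat.
Qed.

Lemma pad_inj (N : nat) : {in lecture_hall N &, injective (pad N)}.
Proof.
move=> s u; rewrite !inE => -[/andP[_ s0] _ _] [/andP[_ u0] _ _].
by move/(congr1 (filter (leq 1))); rewrite !padK.
Qed.

Lemma alt_size_lh (s : seq nat) : lh_seq s -> (`|alt_size s|%N)%:Z = alt_size s.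
Proof.
move=> /lh_sorted srt; rewrite gez0_abs// -(sorted_pad _ srt) alt_size_pad.
apply: alt_size_ge0; rewrite /is_partition filter_all andbT.
by rewrite (sorted_filter (rev_trans leq_trans)).
Qed.

Lemma summable_padded (N : nat) :
  fps2_summable (padded_lecture_hall N)
    (fun s => t ^+ `|alt_size s|%N * q ^+ sumn s).
Proof.
move=> a b; have sum : fps2_summable (lecture_hall N)
    (fun s => t ^+ `|alt_size s|%N * q ^+ sumn s).
  by apply: summable_partitions => mu [].
apply: sub_finite_set (finite_image (pad N) (sum a b)) => s /=.
rewrite padded_lecture_hallE => -[[mu Lmu <-]].
by rewrite alt_size_pad sumn_pad => nz; exists mu.
Qed.

(** The alternating size of a partition is nonnegative, so the integer power of [t] is a natural
    one; padding preserves both weights. *)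
Lemma fps2_sum_lecture_hall (N : nat) :
  fps2_sum (lecture_hall N) (fun mu => t ^ alt_size mu * q ^+ sumn mu) =
  gf (padded_lecture_hall N) (fun s => `|alt_size s|%N) sumn.
Proof.
rewrite padded_lecture_hallE gf_image; last exact: pad_inj.
apply: fpsP => a; apply: fpsP => b; apply: eq_fsbigr => mu.
rewrite inE => -[/alt_size_ge0 alt0 _ _].
congr (fps_coef (fps_coef _ a) b).
by rewrite /= alt_size_pad sumn_pad -{1}(gez0_abs alt0) -exprnP.
Qed.

(** * Evaluation of the lecture hall series *)

Lemma gf_padded_lecture_hall (N : nat) :
  gf (padded_lecture_hall N) (fun s => `|alt_size s|%N) sumn = odd_product N.
Proof.
elim: N => [|N IHN].
  rewrite (_ : padded_lecture_hall 0 = [set [::]]%classic).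
    by rewrite gf_nil// /odd_product /alt_size big_geq.
  by apply/seteqP; split=> [[|x s] []|s ->].
rewrite product_recl -IHN; apply: geometric.
  by rewrite -[q]expr1 unit_1sub_tqn.
rewrite [in LHS]padded_lecture_hallS gfU; first last.
(* The union is disjoint: a bumped head lies strictly above the minimum. *)
- move=> _ [s [_ lhs] <-] [[|x u] [//= _ /andP[ux lhu]] [mE uE]].
  by move: ux; rewrite uE min_head_flip -mE ltnn.
- by rewrite -padded_lecture_hallS; apply: summable_padded.
congr (_ + _).
  rewrite gf_image; last first.
    move=> s u; rewrite !inE => -[_ lhs] [_ lhu] [_ /(congr1 flip)].
    by rewrite !flipK.
  (* [twist] adds twice the alternating size to the size, exactly the change in [sumn_flip]. *)
  rewrite twist_gf; apply: eq_gf => s [_ lhs]; rewrite [LHS]/= -/flip.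
    by rewrite alt_flip.
  have := sumn_flip _ lhs; rewrite -{1}alt_size_lh//=; lia.
(* [bump] raises the size and the alternating size by one each, whence the factor [t * q]. *)
rewrite gf_image; last first.
  by move=> [|x s] [|y u]; rewrite !inE => -[//] _ _ [//] _ _ [-> ->].
rewrite -[t]expr1 -[q in RHS]expr1 -gf_shift.
apply: eq_gf => -[|x s] [//= _ lhs].
have blhs : lh_seq (x.+1 :: s).
  by case/andP: lhs => xs /= ->; rewrite (leq_trans xs (leqnSn x)).
have := alt_size_lh (x :: s) lhs; have := alt_size_lh _ blhs.
rewrite /bump /= !alt_size_cons; lia.
Qed.

Theorem theorem4p2 (N : nat) (hN : (0 < N)%N) :
  fps2_sum (odd_partitions N) (fun la => t ^+ size la * q ^+ sumn la) =
    fps2_sum (lecture_hall N) (fun mu => t ^ alt_size mu * q ^+ sumn mu)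
  /\
  fps2_sum (lecture_hall N) (fun mu => t ^ alt_size mu * q ^+ sumn mu) =
    \prod_(1 <= k < N.+1) (1 - t * q ^+ (2 * k - 1))^-1.
Proof.
rewrite fps2_sum_lecture_hall gf_padded_lecture_hall; split=> //.
exact: gf_odd_partitions.
Qed.
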